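(* Let $n,k$ be positive integers with $n\ge 2k+3$. Then for each sign $\epsilon\in\{+,-\}$, $$1^kR^{D,\epsilon}_{n,1}+3^kR^{D,\epsilon}_{n,3}+5^kR^{D,\epsilon}_{n,5}+\cdots=2^kR^{D,\epsilon}_{n,2}+4^kR^{D,\epsilon}_{n,4}+6^kR^{D,\epsilon}_{n,6}+\cdots.$$
   Context: $\mathfrak{D}_n$ is the set of signed permutations $\pi=\pi_1\cdots\pi_n$ (window notation, $\pi_i\in\{\pm1,\dots,\pm n\}$, $\{|\pi_i|\}=[n]$) with an even number of negative entries. $\mathrm{inv}_D(\pi)=|\{i<j:\pi_i>\pi_j\}|+|\{i<j:-\pi_i>\pi_j\}|$; $\mathfrak{D}_n^+$ is the set of $\pi\in\mathfrak{D}_n$ with $\mathrm{inv}_D(\pi)$ even and $\mathfrak{D}_n^-=\mathfrak{D}_n\setminus\mathfrak{D}_n^+$. Set $\pi_0=0$; $\mathrm{pk}_D(\pi)$ (resp. $\mathrm{val}_D(\pi)$) is the number of $i\in\{1,\dots,n-1\}$ with $\pi_{i-1}<\pi_i>\pi_{i+1}$ (resp. $\pi_{i-1}>\pi_i<\pi_{i+1}$), and $\mathrm{altruns}_D(\pi)=\mathrm{pk}_D(\pi)+\mathrm{val}_D(\pi)+1$. $R^{D,\pm}_{n,j}$ is the number of $\pi\in\mathfrak{D}_n^{\pm}$ with $\mathrm{altruns}_D(\pi)=j$. *)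

(* Defs.v *)
From mathcomp Require Import all_boot all_order all_algebra all_fingroup.

Set Implicit Arguments.
Unset Strict Implicit.
Unset Printing Implicit Defensive.

Import Order.TTheory GRing.Theory Num.Theory.

(* A signed permutation is encoded by the pair of the permutation |pi| and of
   the indicator function of its negative entries; lemmas [window_inj] and
   [windowP] below show that, through [window], these pairs are exactly the
   words pi_1 ... pi_n of nonzero integers such that {|pi_i|} = [n]. *)
Definition signed_perm (n : nat) : finType := ('S_n * {ffun 'I_n -> bool})%type.

Section SignedPerm.

Variable n : nat.
Implicit Types w : signed_perm n.

(* Ordinals start at 0: [window w i] is the letter pi_(i+1). *)
Definition window w (i : 'I_n) : int :=
  ((-1) ^+ (w.2 i) * (w.1 i).+1%:Z)%R.

(* [letter w i] is pi_i for 1 <= i <= n, and pi_0 = 0; the value 0 at i > n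
   is never used. *)
Definition letter w (i : nat) : int :=
  nth 0%R (0%R :: [seq window w j | j <- enum 'I_n]) i.

Definition inv_D w : nat :=
  #|[set p : 'I_n * 'I_n | (p.1 < p.2) && (window w p.1 > window w p.2)%R]|
  + #|[set p : 'I_n * 'I_n | (p.1 < p.2) && (- window w p.1 > window w p.2)%R]|.

Definition pk_D w : nat :=
  #|[set i : 'I_n | [&& 0 < i, (letter w i.-1 < letter w i)%R
                      & (letter w i > letter w i.+1)%R]]|.

Definition val_D w : nat :=
  #|[set i : 'I_n | [&& 0 < i, (letter w i.-1 > letter w i)%R
                      & (letter w i < letter w i.+1)%R]]|.

Definition altruns_D w : nat := pk_D w + val_D w + 1.

Definition Dset : {set signed_perm n} :=
  [set w | ~~ odd #|[set i : 'I_n | (window w i < 0)%R]|].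

Definition Dset_plus : {set signed_perm n} := [set w in Dset | ~~ odd (inv_D w)].

Definition Dset_minus : {set signed_perm n} := Dset :\: Dset_plus.

End SignedPerm.

(* The sign eps is [true] for + and [false] for -. *)
Definition Dset_sign (n : nat) (eps : bool) : {set signed_perm n} :=
  if eps then Dset_plus n else Dset_minus n.

Definition R_D (n : nat) (eps : bool) (j : nat) : nat :=
  #|[set w in Dset_sign n eps | altruns_D w == j]|.

Lemma letter0 n (w : signed_perm n) : letter w 0 = 0%R.
Proof. by []. Qed.

Lemma letterS n (w : signed_perm n) (i : 'I_n) : letter w i.+1 = window w i.
Proof.
by rewrite /letter /= (nth_map i) ?size_enum_ord ?ltn_ord // nth_ord_enum.
Qed.

Lemma absz_window n (w : signed_perm n) i : absz (window w i) = (w.1 i).+1.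
Proof. by rewrite /window abszMsign absz_nat. Qed.

Lemma window_lt0 n (w : signed_perm n) i : (window w i < 0)%R = w.2 i.
Proof. by rewrite /window; case: (w.2 i); rewrite ?expr1 ?mulN1r ?expr0 ?mul1r. Qed.

Lemma window_inj n (w1 w2 : signed_perm n) : window w1 =1 window w2 -> w1 = w2.
Proof.
case: w1 w2 => [s1 e1] [s2 e2] E; congr (_, _).
  apply/permP => i; apply/val_inj/succn_inj.
  by rewrite -(absz_window (s1, e1)) E absz_window.
by apply/ffunP => i; rewrite -(window_lt0 (s1, e1)) E window_lt0.
Qed.

Lemma windowP n (f : 'I_n -> int) :
  (exists w : signed_perm n, window w =1 f)
  <-> (forall m : nat, (exists i, absz (f i) = m) <-> 1 <= m <= n).
Proof.
split=> [[w wf] m | Hf].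
  split=> [[i <-]|/andP[m1 mn]]; first by rewrite -wf absz_window /= ltn_ord.
  have mn' : m.-1 < n by rewrite prednK.
  exists ((w.1^-1)%g (Ordinal mn')).
  by rewrite -wf absz_window permKV /= prednK.
have fb i : 1 <= absz (f i) <= n by apply/Hf; exists i.
have gb i : (absz (f i)).-1 < n by case/andP: (fb i) => h1 h2; rewrite prednK.
pose g i := Ordinal (gb i).
have g_surj y : y \in codom g.
  have [i fi] : exists i, absz (f i) = y.+1 by apply/Hf; rewrite /= ltn_ord.
  by apply/codomP; exists i; apply/val_inj; rewrite /= fi.
have g_inj : injective g.
  apply/injectiveP/card_uniqP; rewrite size_codom.
  by apply: eq_card => y; rewrite g_surj.
exists (perm g_inj, [ffun i => (f i < 0)%R]) => i.
rewrite /window /= permE ffunE /= prednK; last by case/andP: (fb i).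
by rewrite [RHS]intEsign.
Qed.

Lemma altruns_D_le n (w : signed_perm n) : 0 < n -> altruns_D w <= n.
Proof.
case: n w => // n w _; rewrite /altruns_D addn1 ltnS /pk_D /val_D.
set A := [set _ | _]; set B := [set _ | _].
have /eqP <- : #|A :|: B| == #|A| + #|B|.
  rewrite (leq_card_setU A B).2 disjoint_subset.
  apply/subsetP => i; rewrite !inE => /and3P[_ h _].
  by rewrite (lt_gtF h) andbF.
have /subset_leq_card : A :|: B \subset [set~ ord0].
  by apply/subsetP => i; rewrite !inE => /orP[] /and3P[]; rewrite lt0n.
by rewrite cardsC1 card_ord.
Qed.

(* Hence sums over all j >= 1 of multiples of R_D n eps j may be cut at n. *)
Lemma R_D_eq0 n eps j : 0 < n -> n < j -> R_D n eps j = 0.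
Proof.
move=> n0 nj; apply/eqP; rewrite cards_eq0; apply/eqP/setP => w; rewrite !inE.
apply/negbTE; rewrite negb_and; apply/orP; right.
by rewrite neq_ltn (leq_ltn_trans (altruns_D_le w n0) nj).
Qed.

(* Main.v *)
(** Flipping the signs of the last [2a + 2] letters of pi preserves |pi|, hence
    the parity of inv_D, and also preserves the parity of the number of negative
    letters. For [a <= k] it only alters the turning indicators at the two
    positions [j] with [(n - 1 - j) / 2 = a], and it changes the parity of
    altruns_D, because it reverses the last step of 0, pi_1, ..., pi_n and keeps
    the first. Since altruns_D is a sum of turning indicators, altruns_D ^ k is a
    sum of products of [k] of them; by the pigeonhole principle each product is
    preserved by one of the [k + 1] flips, so that it contributes equally to
    both sides. *)
Require Import Defs.
From mathcomp Require Import all_boot all_order all_algebra all_fingroup.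
From mathcomp Require Import zify.

Set Implicit Arguments.
Unset Strict Implicit.
Unset Printing Implicit Defensive.

Import Order.TTheory GRing.Theory Num.Theory.

Lemma card_sum_mem (T : finType) (A : {set T}) : #|A| = \sum_x (x \in A).
Proof. by rewrite -sum1_card big_mkcond; apply: eq_bigr => x _; case: (x \in A). Qed.

Lemma odd_card (T : finType) (A : {set T}) :
  odd #|A| = \big[addb/false]_x (x \in A).
Proof.
rewrite card_sum_mem (big_morph odd oddD (erefl _)).
by apply: eq_bigr => x _; rewrite oddb.
Qed.

Lemma exists_notin_codom (k : nat) (f : 'I_k -> nat) :
  exists2 a, a <= k & forall i, f i != a.
Proof.
have /allPn[a] : ~~ all (mem (codom f)) (iota 0 k.+1).
  apply/negP => /allP/(uniq_leq_size (iota_uniq 0 k.+1)).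
  by rewrite size_iota size_codom card_ord ltnn.
rewrite mem_iota ltnS => ak fa; exists a => // i.
by apply: contraNneq fa => <-; apply: codom_f.
Qed.

Section Turns.

Variable n : nat.
Implicit Types w : signed_perm n.

(** This makes every step strict, so [asc] being false means a descent. *)
Lemma letter_neq w j : j < n -> letter w j != letter w j.+1.
Proof.
move=> jn; rewrite (letterS w (Ordinal jn)); case: j => [|j] in jn *.
  by rewrite letter0 eq_sym -absz_eq0 absz_window.
rewrite (letterS w (Ordinal (ltnW jn))); apply/negP => /eqP/(congr1 absz).
rewrite !absz_window => -[] /val_inj/perm_inj/(congr1 val) /=; lia.
Qed.

Definition asc w (j : nat) : bool := (letter w j < letter w j.+1)%R.

(* The value at 0 accounts for the summand 1 of [altruns_D]. *)
Definition turn w (j : nat) : bool :=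
  if j is j'.+1 then asc w j' (+) asc w j else true.

Lemma altruns_turn w : 0 < n -> altruns_D w = \sum_(j < n) turn w j.
Proof.
move=> n0; rewrite /altruns_D /pk_D /val_D !card_sum_mem -big_split /=.
rewrite (bigD1 (Ordinal n0)) // [RHS](bigD1 (Ordinal n0)) //= !inE /= add0n.
rewrite addn1 add1n; congr _.+1.
apply: eq_bigr => -[[|j] jn] //= _; rewrite !inE /= /asc.
have := letter_neq w jn; have := letter_neq w (ltnW jn).
by case: ltgtP => // _ _; case: ltgtP.
Qed.

(** Modulo 2 the sum of turns telescopes; the negation comes from the 1 at position 0. *)
Lemma odd_altruns w : 0 < n -> odd (altruns_D w) = ~~ (asc w 0 (+) asc w n.-1).
Proof.
move=> n0; rewrite altruns_turn // -(prednK n0).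
elim: n.-1 => [|m IHm]; first by rewrite big_ord_recr big_ord0 addbb.
rewrite big_ord_recr oddD IHm oddb /=.
by case: (asc w 0); case: (asc w m); case: (asc w m.+1).
Qed.

(** For i < j, if |pi_i| > |pi_j| then exactly one of pi_i and -pi_i exceeds pi_j; otherwise both or
    neither do. *)
Lemma odd_inv_D w :
  odd (inv_D w) =
    odd #|[set p : 'I_n * 'I_n | (p.1 < p.2) && (w.1 p.2 < w.1 p.1)]|.
Proof.
rewrite /inv_D oddD !odd_card -big_split; apply: eq_bigr => -[i j] _ /=.
rewrite !inE /=; case: ltnP => //= ij.
have: w.1 i != w.1 j by rewrite (inj_eq perm_inj) neq_ltn ij.
rewrite -val_eqE /window /=.
by case: (w.2 i); case: (w.2 j); rewrite ?expr1 ?expr0; lia.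
Qed.

Definition flip (p : nat) w : signed_perm n :=
  (w.1, [ffun i => w.2 i (+) (p <= i)]).

Lemma flipK p : involutive (flip p).
Proof.
by case=> s e; congr (_, _); apply/ffunP => i; rewrite !ffunE -addbA addbb addbF.
Qed.

Lemma letter_flip p w j : j <= n ->
  letter (flip p w) j = if p < j then (- letter w j)%R else letter w j.
Proof.
case: j => [|j] jn; first by rewrite !letter0 oppr0; case: (p < 0).
rewrite !(letterS _ (Ordinal jn)) /window /= ffunE /= ltnS.
by case: ifP => _; rewrite ?addbF // addbT signrN mulNr.
Qed.

(** Only step [p] joins a kept letter to a negated one; any other step is kept or reversed as a
    whole. *)
Lemma asc_flip p w j : j < n -> j != p -> asc (flip p w) j = asc w j (+) (p < j).
Proof.
move=> jn jp; rewrite /asc !letter_flip //; last exact: ltnW.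
have -> : (p < j.+1) = (p < j) by lia.
case: (p < j); last by rewrite addbF.
by rewrite addbT ltrN2 -leNgt lt_neqAle eq_sym letter_neq.
Qed.

(** The turn at [j] compares steps [j.-1] and [j]; when neither is step [p], both are kept or both
    reversed. *)
Lemma turn_flip p w j : j < n -> j != p -> j != p.+1 ->
  turn (flip p w) j = turn w j.
Proof.
case: j => [|j] //= jn jp jp1; rewrite !asc_flip //; last exact: ltnW.
have -> : (p < j.+1) = (p < j) by lia.
by rewrite addbACA addbb addbF.
Qed.

Lemma odd_altruns_flip p w : 0 < p < n.-1 ->
  odd (altruns_D (flip p w)) = ~~ odd (altruns_D w).
Proof.
case/andP=> p0 pn; have n0 : 0 < n by lia.
by rewrite !odd_altruns // !asc_flip; lia.
Qed.

Lemma flip_Dset p w : p <= n -> ~~ odd (n - p) ->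
  (flip p w \in Dset n) = (w \in Dset n).
Proof.
move=> pn even_np; rewrite !inE; congr (~~ _); rewrite !odd_card.
transitivity (\big[addb/false]_i ((i \in [set i | window w i < 0]%R)
                                   (+) (i \in [set i : 'I_n | p <= i]))).
  by apply: eq_bigr => i _; rewrite !inE !window_lt0 ffunE.
rewrite big_split -!odd_card /=.
suff -> : #|[set i : 'I_n | p <= i]| = n - p by rewrite (negbTE even_np) addbF.
rewrite -sum1dep_card -(big_geq_mkord _ _ xpredT (fun=> 1)).
by rewrite sum_nat_const_nat muln1.
Qed.

Lemma flip_Dset_sign p w eps : p <= n -> ~~ odd (n - p) ->
  (flip p w \in Dset_sign n eps) = (w \in Dset_sign n eps).
Proof.
move=> pn even_np; have e := flip_Dset w pn even_np.
(* This parity depends only on [w.1], which [flip] keeps. *)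
have o : odd (inv_D (flip p w)) = odd (inv_D w) by rewrite !odd_inv_D.
by case: eps; rewrite /= ?in_setD ![_ \in Dset_plus _]inE e o.
Qed.

Lemma sum_R_D (P : pred nat) (F : nat -> nat) eps : 0 < n ->
  \sum_(1 <= j < n.+1 | P j) F j * R_D n eps j
  = \sum_(w in Dset_sign n eps | P (altruns_D w)) F (altruns_D w).
Proof.
move=> n0.
have altruns_bound w : 0 < altruns_D w <= n.
  by rewrite altruns_D_le // /altruns_D addn1.
pose G j w := (altruns_D w == j) * F (altruns_D w).
transitivity (\sum_(1 <= j < n.+1 | P j) \sum_(w in Dset_sign n eps) G j w).
  apply: eq_bigr => j _; rewrite /R_D -sum1dep_card big_distrr /= big_mkcondr.
  by apply: eq_bigr => w _; rewrite /G muln1; case: eqP => [->|]; rewrite ?mul1n.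
rewrite exchange_big [RHS]big_mkcondr; apply: eq_bigr => w _ /=.
rewrite big_mkcond (bigD1_seq (altruns_D w)) ?iota_uniq ?mem_index_iota //=.
rewrite big1 ?addn0 /G ?eqxx ?mul1n // => j jw.
by rewrite eq_sym (negbTE jw) if_same.
Qed.

End Turns.

Theorem theorem57 (n k : nat) (n_gt0 : 0 < n) (k_gt0 : 0 < k)
    (n_ge : 2 * k + 3 <= n) (eps : bool) :
  \sum_(1 <= j < n.+1 | odd j) j ^ k * R_D n eps j
  = \sum_(1 <= j < n.+1 | ~~ odd j) j ^ k * R_D n eps j.
Proof.
rewrite (sum_R_D odd (expn^~ k)) // (sum_R_D (predC odd) (expn^~ k)) //=.
have altruns_expn (w : signed_perm n) :
    altruns_D w ^ k = \sum_(J : {ffun 'I_k -> 'I_n}) \prod_i turn w (J i).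
  rewrite -(bigA_distr_bigA (fun (_ : 'I_k) (j : 'I_n) => turn w j : nat)).
  by rewrite -altruns_turn // prod_nat_const card_ord.
under eq_bigr do rewrite altruns_expn.
under [RHS]eq_bigr do rewrite altruns_expn.
rewrite exchange_big [RHS]exchange_big; apply: eq_bigr => J _ /=.
(* The halves are equal to [a] exactly at the positions [p] and [p.+1] for the [p] below, so [J]
   avoids both. *)
have [a ak Ja] := exists_notin_codom (fun i => (n.-1 - J i)./2).
(* From [a <= k] and [2 * k + 3 <= n] one gets [0 < p], so the first step is kept. *)
pose p := n - a.+1.*2.
rewrite (reindex_inj (inv_inj (@flipK n p))) /=.
apply: eq_big => [w|w _].
  by rewrite flip_Dset_sign ?odd_altruns_flip; lia.
apply: eq_bigr => i _; have /= := Ja i; have := ltn_ord (J i) => Jn Jia.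
by rewrite turn_flip //; lia.
Qed.
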